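(* Let $(S,\mathfrak{F},\tau)$ be a probabilistic metric space with $\tau$ continuous, and let $I$ be a strongly admissible ideal of $\mathbb{N}\times\mathbb{N}$ with the property $(AP_2)$. Then the notions of strong $I$-statistically pre-Cauchy and strong $I^*$-statistically pre-Cauchy coincide: a double sequence $x=(x_{jk})_{j,k\in\mathbb{N}}$ in $S$ is strong $I$-statistically pre-Cauchy if and only if it is strong $I^*$-statistically pre-Cauchy.
   Context: Ideals. An ideal on a set $X$ is a class $I\subseteq 2^X$ with $\emptyset\in I$, closed under finite unions and under taking subsets; it is non-trivial if $X\notin I$. For a non-trivial ideal $I$ on $X$, $\mathbb{F}(I)=\{X\setminus A: A\in I\}$ is the filter associated with $I$. A non-trivial ideal $I$ of $\mathbb{N}\times\mathbb{N}$ is strongly admissible if $\{i\}\times\mathbb{N}\in I$ and $\mathbb{N}\times\{i\}\in I$ for each $i\in\mathbb{N}$. It has the property $(AP_2)$ if for every countable family of mutually disjoint sets $\{A_1,A_2,\ldots\}$ belonging to $I$ there exists a countable family of sets $\{B_1,B_2,\ldots\}$ such that $A_j\Delta B_j$ is included in a finite union of rows and columns of $\mathbb{N}\times\mathbb{N}$ for each $j\in\mathbb{N}$, and $B=\bigcup_{j=1}^\infty B_j\in I$ (here $\Delta$ is symmetric difference). Probabilistic metric spaces. $\Delta^+$ is the set of non-decreasing functions $G:[0,\infty]\to[0,1]$ with $G(0)=0$, $G(\infty)=1$, left continuous on $(0,\infty)$ (extended by $G(x)=0$ for $x<0$), ordered pointwise. $\epsilon_0\in\Delta^+$ is given by $\epsilon_0(x)=0$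 for $x\le 0$ and $\epsilon_0(x)=1$ for $x>0$. For $F,G\in\Delta^+$, $d_L(F,G)$ is the infimum of all $h\in(0,1]$ such that $F(x-h)-h\le G(x)\le F(x+h)+h$ and $G(x-h)-h\le F(x)\le G(x+h)+h$ for every $x\in(-1/h,1/h)$; $d_L$ is a metric on $\Delta^+$. A triangle function is a binary operation $\tau:\Delta^+\times\Delta^+\to\Delta^+$ that is commutative, associative, non-decreasing in each place, and has $\epsilon_0$ as identity; continuity of $\tau$ is with respect to $d_L$. A probabilistic metric (PM) space is a triple $(S,\mathfrak{F},\tau)$ with $S$ a nonempty set, $\tau$ a triangle function, and $\mathfrak{F}:S\times S\to\Delta^+$, $\mathfrak{F}(x,y)=F_{xy}$, such that for all $x,y,z\in S$: $F_{xx}=\epsilon_0$; $F_{xy}\ne\epsilon_0$ if $x\ne y$; $F_{xy}=F_{yx}$; $F_{xz}\ge\tau(F_{xy},F_{yz})$. For $t>0$ put $\mathfrak{U}(t)=\{(x,y)\in S\times S: F_{xy}(t)>1-t\}$. A double sequence $(x_{jk})$ in $S$ is strong $I$-statistically pre-Cauchy if for all $t>0$ and $\delta>0$, $$\left\{(m,n)\in\mathbb{N}\times\mathbb{N}:\tfrac{1}{m^2n^2}\left|\{(j,k,p,q): (x_{jk},x_{pq})\notin\mathfrak{U}(t),\ j,p\le m,\ k,q\le n\}\right|\ge\delta\right\}\in I.$$ It is strong $I^*$-statistically pre-Cauchy if there exists $M\in\mathbb{F}(I)$ such that for every $t>0$ $$\lim_{\substack{m,n\to\infty\\(m,n)\in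 M}}\tfrac{1}{m^2n^2}\left|\{(j,k,p,q): d_L(F_{x_{jk}x_{pq}},\epsilon_0)\ge t,\ j,p\le m,\ k,q\le n\}\right|=0,$$ i.e. for every $\epsilon>0$ there is $n_0$ such that the expression is $<\epsilon$ for all $(m,n)\in M$ with $m,n\ge n_0$. *)

(* Defs.v *)
From HB Require Import structures.
From mathcomp Require Import all_boot all_order all_algebra finmap.
From mathcomp Require Import all_classical all_reals all_analysis.
Import Order.TTheory GRing.Theory Num.Theory.
Import numFieldNormedType.Exports.

Set Implicit Arguments.
Unset Strict Implicit.
Unset Printing Implicit Defensive.

Local Open Scope classical_set_scope.
Local Open Scope ring_scope.

(* The index set N = {1, 2, ...}: the densities below divide by m^2 n^2. *)
Notation posN := {n : nat | (0 < n)%N}.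

Record is_ideal (X : Type) (I : set (set X)) : Prop := IsIdeal {
  ideal0 : I set0;
  idealU : forall A B, I A -> I B -> I (A `|` B);
  idealS : forall A B, A `<=` B -> I B -> I A }.

Definition nontrivial_ideal (X : Type) (I : set (set X)) : Prop :=
  is_ideal I /\ ~ I setT.

Definition ideal_filter (X : Type) (I : set (set X)) : set (set X) :=
  [set ~` A | A in I].

Definition grid_row (i : posN) : set (posN * posN) := [set i] `*` setT.
Definition grid_col (i : posN) : set (posN * posN) := setT `*` [set i].

Record strongly_admissible (I : set (set (posN * posN))) : Prop :=
  StronglyAdmissible {
  sadm_nontrivial : nontrivial_ideal I;
  sadm_row : forall i, I (grid_row i);
  sadm_col : forall i, I (grid_col i) }.

Definition AP2 (I : set (set (posN * posN))) : Prop :=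
  forall A : nat -> set (posN * posN),
    (forall l, I (A l)) -> trivIset setT A ->
  exists B : nat -> set (posN * posN),
    (forall l, exists C D : set posN,
       [/\ finite_set C, finite_set D &
           A l `+` B l `<=`
             \bigcup_(i in C) grid_row i `|` \bigcup_(i in D) grid_col i]) /\
    I (\bigcup_l B l).

(* Elements of Delta^+ live on [0, +oo] and are extended by 0 to the negative
   half-line; they are encoded as functions on the whole of \bar R. The
   extension is then determined by the values on [0, +oo]. *)
Record is_ddf (R : realType) (G : \bar R -> R) : Prop := IsDdf {
  ddf_range : forall x, 0 <= G x <= 1;
  ddf_npos : forall x : \bar R, (x <= 0)%E -> G x = 0;
  ddf_pinfty : G +oo%E = 1;
  ddf_mono : forall x y : \bar R, (x <= y)%E -> G x <= G y;
  ddf_left_cont : forall x : R, 0 < x ->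
    (fun y : R => G y%:E) @ x^'- --> G x%:E }.

Record ddf (R : realType) := Ddf {
  ddf_fun :> \bar R -> R;
  ddfP : is_ddf ddf_fun }.

Definition ddf_le (R : realType) (F G : ddf R) : Prop :=
  forall x : \bar R, F x <= G x.

Lemma ddf_ext (R : realType) (F G : ddf R) :
  (forall x : \bar R, F x = G x) -> F = G.
Proof.
case: F G => [f fP] [g gP] /= /funext fg; subst g; congr Ddf.
exact: Prop_irrelevance.
Qed.

Definition eps0_fun (R : realType) (x : \bar R) : R :=
  if (0 < x)%E then 1 else 0.

Lemma eps0_subproof (R : realType) : is_ddf (@eps0_fun R).
Proof.
split; rewrite /eps0_fun.
- by move=> x; case: ifP => _; rewrite ?lexx ?ler01.
- by move=> x; rewrite leNgt => /negbTE ->.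
- by rewrite ltry.
- move=> x y xy; case: ifPn => x0; last by case: ifP.
  by rewrite (lt_le_trans x0 xy).
- move=> x x0; rewrite lte_fin x0; apply: cvg_near_cst.
  by apply: filterS (nbhs_left_gt x0) => y y0; rewrite lte_fin y0.
Qed.

Definition eps0 (R : realType) : ddf R := Ddf (@eps0_subproof R).

Definition dL (R : realType) (F G : ddf R) : R :=
  inf [set h : R | 0 < h <= 1 /\
    forall x : R, - h^-1 < x < h^-1 ->
      F (x - h)%:E - h <= G x%:E <= F (x + h)%:E + h /\
      G (x - h)%:E - h <= F x%:E <= G (x + h)%:E + h].

Record triangle_function (R : realType) (tau : ddf R -> ddf R -> ddf R) : Prop :=
  TriangleFunction {
  triC : forall F G, tau F G = tau G F;
  triA : forall F G H, tau F (tau G H) = tau (tau F G) H;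
  tri_monol : forall F G H, ddf_le F G -> ddf_le (tau F H) (tau G H);
  tri_monor : forall F G H, ddf_le F G -> ddf_le (tau H F) (tau H G);
  tri_eps0 : forall F, tau F (eps0 R) = F }.

Definition dL_continuous (R : realType) (tau : ddf R -> ddf R -> ddf R) : Prop :=
  forall (F G : ddf R) (e : R), 0 < e ->
  exists2 d : R, 0 < d &
    forall F' G', dL F F' < d -> dL G G' < d -> dL (tau F G) (tau F' G') < e.

Record PM_space (R : realType) (S : Type) (F : S -> S -> ddf R)
    (tau : ddf R -> ddf R -> ddf R) : Prop := PMSpace {
  PM_nonempty : inhabited S;
  PM_triangle_function : triangle_function tau;
  PM_refl : forall x, F x x = eps0 R;
  PM_sep : forall x y, x <> y -> F x y <> eps0 R;
  PM_sym : forall x y, F x y = F y x;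
  PM_triangle : forall x y z, ddf_le (tau (F x y) (F y z)) (F x z) }.

Definition strong_vicinity (R : realType) (S : Type) (F : S -> S -> ddf R)
    (t : R) : set (S * S) :=
  [set z | F z.1 z.2 t%:E > 1 - t].

(* The quadruples ((j, k), (p, q)) with j, p <= m, k, q <= n and
   (x_jk, x_pq) in E. *)
Definition index_quadruples (S : Type) (x : posN -> posN -> S)
    (E : set (S * S)) (m n : posN) : set ((posN * posN) * (posN * posN)) :=
  [set u | [/\ E (x u.1.1 u.1.2, x u.2.1 u.2.2),
             (val u.1.1 <= val m)%N, (val u.2.1 <= val m)%N,
             (val u.1.2 <= val n)%N & (val u.2.2 <= val n)%N]].

Lemma finite_posN_le (m : posN) : finite_set [set j : posN | (val j <= val m)%N].
Proof.
apply: (@finite_preimage _ _ `I_(val m).+1 val).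
  by move=> ? ? _ _; exact: val_inj.
exact: finite_II.
Qed.

(* fset_set returns the empty set on infinite sets; this does not happen here. *)
Lemma finite_index_quadruples (S : Type) (x : posN -> posN -> S)
    (E : set (S * S)) (m n : posN) : finite_set (index_quadruples x E m n).
Proof.
pose Q := [set j : posN | (val j <= val m)%N] `*`
          [set k : posN | (val k <= val n)%N].
have Qfin : finite_set Q by apply: finite_setX; exact: finite_posN_le.
apply: (@sub_finite_set _ _ (Q `*` Q)); last exact: finite_setX.
by move=> u [].
Qed.

Definition pair_density (R : realType) (S : Type) (x : posN -> posN -> S)
    (E : set (S * S)) (m n : posN) : R :=
  (((val m)%:R ^+ 2 * (val n)%:R ^+ 2)^-1) *
  (#|` fset_set (index_quadruples x E m n)|)%:R.

Definition strong_I_stat_pre_Cauchy (R : realType) (S : Type)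
    (F : S -> S -> ddf R) (I : set (set (posN * posN)))
    (x : posN -> posN -> S) : Prop :=
  forall t d : R, 0 < t -> 0 < d ->
  I [set mn | d <= pair_density R x (~` strong_vicinity F t) mn.1 mn.2].

Definition strong_Istar_stat_pre_Cauchy (R : realType) (S : Type)
    (F : S -> S -> ddf R) (I : set (set (posN * posN)))
    (x : posN -> posN -> S) : Prop :=
  exists2 M : set (posN * posN), ideal_filter I M &
  forall t : R, 0 < t -> forall e : R, 0 < e ->
  exists n0 : posN, forall m n : posN, M (m, n) ->
    (val n0 <= val m)%N -> (val n0 <= val n)%N ->
    pair_density R x [set z | t <= dL (F z.1 z.2) (eps0 R)] m n < e.

(* Main.v *)
(** By left continuity, [t <= dL F eps0] holds exactly when [F t <= 1 - t], so
    both notions concern the same densities, which decrease in [t].  If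
    the densities tend to 0 along the complement of a set of [I], each
    exceptional set is covered by that set and finitely many rows and columns.
    Conversely, let [C_k] be the exceptional set of [t = d = 1/(k+1)], make the
    [C_k] disjoint, and let [B] be the set of [I] given by (AP2).  Outside [B],
    each [C_k] lies in finitely many rows and columns, so the densities tend to
    0 along the complement of [B]. *)
Require Import Defs.
From mathcomp Require Import all_boot all_order all_algebra finmap.
From mathcomp Require Import all_classical all_reals all_analysis.
From mathcomp Require Import lra.
Import Order.TTheory GRing.Theory Num.Theory.
Import numFieldNormedType.Exports.

Set Implicit Arguments.
Unset Strict Implicit.
Unset Printing Implicit Defensive.

Local Open Scope classical_set_scope.
Local Open Scope ring_scope.

Section distance_to_eps0.
Variables (R : realType) (F : ddf R).

Lemma eps0E (y : R) : eps0 R y%:E = (0 < y)%R%:R.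
Proof. by rewrite /= /eps0_fun lte_fin; case: ifP. Qed.

(** The number [h] itself belongs to the set whose infimum is [dL F (eps0 R)]: where [eps0] takes
    the value 1, monotonicity gives [F h <= F y] or [F h <= F (y + h)], and the other inequalities
    hold because [F] vanishes at nonpositive arguments. *)
Lemma dL_eps0_le (h : R) : 0 < h <= 1 -> 1 - h <= F h%:E -> dL F (eps0 R) <= h.
Proof.
move=> /andP[h0 h1] Fh; apply: ge_inf.
  by exists 0 => y [/andP[/ltW]].
split=> [|y _]; first by rewrite h0.
have F01 z : 0 <= F z <= 1 := ddf_range (ddfP F) z.
have Fmono (a b : R) : a <= b -> F a%:E <= F b%:E.
  by move=> ab; apply: (ddf_mono (ddfP F)); rewrite lee_fin.
have F0 (a : R) : a <= 0 -> F a%:E = 0.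
  by move=> a0; apply: (ddf_npos (ddfP F)); rewrite lee_fin.
rewrite !eps0E.
have := F01 (y - h)%:E; have := F01 (y + h)%:E; have := F01 y%:E.
case: (ltrP 0 y) => y0; case: (ltrP 0 (y - h)) => yh; case: (ltrP 0 (y + h)) => yh'.
all: try (have := F0 _ y0); try (have := F0 _ yh); try (have := F0 _ yh').
all: try (have : F h%:E <= F (y + h)%:E by apply: Fmono; lra).
all: try (have : F h%:E <= F y%:E by apply: Fmono; lra).
all: by rewrite ?mulr1n ?mulr0n => *; split; apply/andP; split; lra.
Qed.

Lemma dL_eps0_lt (t : R) : 0 < t -> (dL F (eps0 R) < t) = (1 - t < F t%:E).
Proof.
move=> t0.
have F01 z : 0 <= F z <= 1 := ddf_range (ddfP F) z.
have F1 : dL F (eps0 R) <= 1.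
  by apply: dL_eps0_le; [lra | have := F01 1%:E; lra].
apply/idP/idP => [|Ft].
  case/inf_lt => [|h [/andP[h0 h1] H] ht].
    (* The infimum is over a nonempty set: 1 always belongs to it, as all values lie in [0, 1]. *)
    apply/set0P/eqP => E0; move: F1; rewrite /dL E0 inf0 => _.
    have : [set h : R | 0 < h <= 1 /\
      forall x : R, - h^-1 < x < h^-1 ->
      F (x - h)%:E - h <= eps0 R x%:E <= F (x + h)%:E + h /\
      eps0 R (x - h)%:E - h <= F x%:E <= eps0 R (x + h)%:E + h] 1.
      split=> [|x _]; first by rewrite ltr01 lexx.
      rewrite !eps0E; have := F01 (x - 1)%:E; have := F01 (x + 1)%:E.
      have := F01 x%:E.
      by do 3 case: ltrP => _; rewrite ?mulr1n ?mulr0n => *; split; apply/andP; split; lra.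
    by rewrite E0.
  have hV : 0 < h^-1 by rewrite invr_gt0.
  (* A positive test point below [h^-1] with [y + h <= t]: there the condition on [h] reads
     [1 <= F (y + h) + h], hence [1 - t < 1 - h <= F t]. *)
  pose y := Num.min (t - h) (h^-1 / 2).
  have y0 : 0 < y by rewrite lt_min; apply/andP; split; lra.
  have yt : y <= t - h by rewrite ge_min lexx.
  have yh : y <= h^-1 / 2 by rewrite ge_min lexx orbT.
  have [|/andP[_ +] _] := H y; first by apply/andP; split; lra.
  rewrite eps0E y0 mulr1n => Hy.
  have : F (y + h)%:E <= F t%:E.
    by apply: (ddf_mono (ddfP F)); rewrite lee_fin; lra.
  lra.
have [t1|t1] := ltP 1 t; first exact: le_lt_trans F1 t1.
have Fcvg := ddf_left_cont (ddfP F) t0.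
(* Half of the gap is spent on moving [t] down to [h], the other half on the drop from [F t] to
   [F h]; this leaves [1 - h < F h]. *)
have e0 : 0 < (F t%:E - (1 - t)) / 2 by lra.
near t^'- => h.
have h0 : 0 < h by near: h; exact: nbhs_left_gt.
have ht : h < t by near: h; exact: nbhs_left_lt.
have h2 : t - (F t%:E - (1 - t)) / 2 < h by near: h; apply: nbhs_left_gt; lra.
have Fh : F t%:E - (F t%:E - (1 - t)) / 2 < F h%:E.
  by near: h; apply: (cvgr_gt _ Fcvg); lra.
apply: (le_lt_trans _ ht); apply: dL_eps0_le; last lra.
by apply/andP; split; lra.
Unshelve. all: by end_near. Qed.

End distance_to_eps0.

Lemma pair_density_sub (R : realType) (S : Type) (x : posN -> posN -> S)
    (E E' : set (S * S)) (m n : posN) :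
  E `<=` E' -> pair_density R x E m n <= pair_density R x E' m n.
Proof.
move=> EE'; rewrite /pair_density ler_wpM2l //.
rewrite ler_nat; apply: fsubset_leq_card.
rewrite -fset_set_sub; try exact: finite_index_quadruples.
by move=> u [/EE' Eu *]; split.
Qed.

Lemma finite_posN_ltn (C : set posN) : finite_set C ->
  exists N : nat, forall i, C i -> (val i < N)%N.
Proof.
move=> /finite_seqP[s ->]; exists (\max_(i <- s) val i).+1 => i si.
by rewrite ltnS; apply: leq_bigmax_seq.
Qed.

Lemma ideal_lt_or_lt (I : set (set (posN * posN))) (N : nat) :
  strongly_admissible I ->
  I [set mn | (val mn.1 < N)%N \/ (val mn.2 < N)%N].
Proof.
move=> [[Iideal _] Irow Icol]; elim: N => [|N IH].
  by apply: (idealS Iideal) (ideal0 Iideal) => mn [].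
(* Indices start at 1, so for [N = 0] the set is still empty; otherwise row [N] and column [N] are
   added. *)
have [N0|N0] := posnP N.
  apply: (idealS Iideal) (ideal0 Iideal) => mn [] /=; rewrite N0 ltnS leqNgt.
    by rewrite (valP mn.1).
  by rewrite (valP mn.2).
pose i : posN := exist _ N N0.
apply: (idealS Iideal) (idealU Iideal IH (idealU Iideal (Irow i) (Icol i))).
move=> mn [] /=; rewrite ltnS leq_eqVlt => /orP[/eqP mnN|mnN].
- by right; left; split=> //=; exact: val_inj.
- by left; left.
- by right; right; split=> //=; exact: val_inj.
- by left; right.
Qed.

Theorem theorem3p6 (R : realType) (S : Type) (F : S -> S -> ddf R)
    (tau : ddf R -> ddf R -> ddf R) (I : set (set (posN * posN)))
    (hPM : PM_space F tau) (htau : dL_continuous tau)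
    (hI : strongly_admissible I) (hAP2 : AP2 I) (x : posN -> posN -> S) :
  strong_I_stat_pre_Cauchy F I x <-> strong_Istar_stat_pre_Cauchy F I x.
Proof.
have Iideal := (sadm_nontrivial hI).1.
pose far t : set (S * S) := [set z | t <= dL (F z.1 z.2) (eps0 R)].
have farE (t : R) : 0 < t -> ~` strong_vicinity F t = far t.
  move=> t0; apply/seteqP; split=> z; rewrite /strong_vicinity /far /=.
    by rewrite -dL_eps0_lt // => /negP; rewrite -leNgt.
  by rewrite -dL_eps0_lt // leNgt => /negP.
split=> [preC|[_ [A IA <-] preC] t d t0 d0]; last first.
  have [n0 Hn0] := preC t t0 d d0.
  apply: (idealS Iideal) (idealU Iideal IA (ideal_lt_or_lt (val n0) hI)).
  move=> [m n] /=; rewrite farE // => dmn.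
  apply: contrapT => /not_orP[Amn /not_orP[/negP + /negP]].
  rewrite -!leqNgt => n0m n0n.
  by have := Hn0 m n Amn n0m n0n; rewrite ltNge dmn.
pose C (k : nat) : set (posN * posN) :=
  [set mn | k.+1%:R^-1 <= pair_density R x (far k.+1%:R^-1) mn.1 mn.2].
have IC k : I (C k).
  have k0 : 0 < k.+1%:R^-1 :> R by rewrite invr_gt0 ltr0n.
  by have := preC _ _ k0 k0; rewrite farE.
have IC' k : I (seqDU C k) := idealS Iideal (@subset_seqDU _ C k) (IC k).
have [B [CB IB]] := hAP2 _ IC' (@trivIset_seqDU _ C).
exists (~` \bigcup_l B l); first by exists (\bigcup_l B l).
move=> t t0 e e0.
(* [N l] exceeds the indices of the finitely many rows and columns that cover the part of the [l]-th
   disjoint piece outside [B l]. *)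
have /choice[N HN] : forall l, exists N : nat, forall mn,
    (seqDU C l `\` B l) mn -> (val mn.1 < N)%N \/ (val mn.2 < N)%N.
  move=> l; have [P [Q [/finite_posN_ltn[p Pp] /finite_posN_ltn[q Qq] PQ]]] := CB l.
  exists (maxn p q) => mn CBmn.
  have /PQ : (seqDU C l `+` B l) mn by left.
  move=> [[i Pi [mni _]]|[i Qi [_ mni]]]; [left|right]; rewrite mni leq_max.
    by rewrite Pp.
  by rewrite Qq // orbT.
have [k] : exists k, 0 + k.+1%:R^-1 < Num.min t e.
  by apply: ltr_add_invr; rewrite lt_min t0.
rewrite add0r lt_min => /andP[kt ke].
(* Only the pieces with [l <= k] matter, as they already cover [C k]; the successor makes the
   threshold a positive index. *)
exists (exist _ (\max_(l < k.+1) N l).+1 isT) => m n /= Bmn Nm Nn.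
rewrite ltNge; apply/negP => emn.
(* A violation for [(t, e)] is one for [k.+1%:R^-1], which is below both: lowering [t] enlarges
   [far t]. *)
have Cmn : C k (m, n).
  apply: le_trans (ltW ke) _; apply: le_trans emn _.
  by apply: pair_density_sub => z; apply: le_trans; exact: ltW.
have : (\big[setU/set0]_(l < k.+1) seqDU C l) (m, n).
  by rewrite -bigsetU_seqDU big_ord_recr; right.
rewrite -bigcup_mkord => -[l /= lk Clmn].
have Nl : (N l <= \max_(l < k.+1) N l)%N.
  exact: (leq_bigmax (Ordinal lk)).
have [|/=|/=] := HN l (m, n).
- by split => // Blmn; apply: Bmn; exists l.
- by rewrite ltnNge (leq_trans Nl (ltnW Nm)).
- by rewrite ltnNge (leq_trans Nl (ltnW Nn)).
Qed.
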